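(* Let $P=(X,\prec)$ be a finite poset on $n=|X|$ points with no universal line, and suppose its height $h(P)$ satisfies $h(P)\ge 2$. Then $P$ induces at least $$h(P)\binom{\lfloor n/h(P)\rfloor}{2}+\lfloor n/h(P)\rfloor\,(n \bmod h(P))+h(P)$$ distinct lines.
   Context: Let $P=(X,\prec)$ be a finite poset, where $\prec$ denotes the strict order relation on $X$. The height $h(P)$ is the size (number of elements) of a maximum chain in $P$. For points $a,b,c\in X$, write $[abc]$ (read ''$b$ is between $a$ and $c$'') if $a\prec b\prec c$ or $c\prec b\prec a$. For any two distinct points $a,b\in X$, the line $\overline{ab}$ is the subset of $X$ defined by $\overline{ab}=\{a,b\}\cup\{x\in X: [xab]\text{ or }[axb]\text{ or }[abx]\}$. Equivalently, if $a,b$ are incomparable then $\overline{ab}=\{a,b\}$, and if $a,b$ are comparable then $\overline{ab}=\{a,b\}\cup\{x : x\text{ is comparable to both }a\text{ and }b\}$. The lines induced by $P$ are the sets $\overline{ab}$ for distinct $a,b\in X$; two lines are distinct if they differ as subsets of $X$. A line is universal if it equals $X$. Here $n \bmod h$ denotes the remainder of $n$ on division by $h$, and $\binom{m}{2}=m(m-1)/2$. *)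

(* Defs.v *)
From mathcomp Require Import all_boot all_order.
Set Implicit Arguments.
Unset Strict Implicit.
Unset Printing Implicit Defensive.
Import Order.TTheory.

Definition chain d (X : finPOrderType d) (C : {set X}) : bool :=
  [forall x in C, forall y in C, (x >=< y)%O].

(* The height counts the points of a longest chain, not the steps between
   them, so a nonempty antichain has height 1. *)
Definition height d (X : finPOrderType d) : nat :=
  \max_(C : {set X} | chain C) #|C|.

Definition between d (X : finPOrderType d) (a b c : X) : bool :=
  (a < b < c)%O || (c < b < a)%O.

(* Meant for a != b; [lines] only uses it for such pairs. *)
Definition line d (X : finPOrderType d) (a b : X) : {set X} :=
  [set a; b] :|: [set x | [|| between x a b, between a x b | between a b x]].

(* Lines are collected as subsets of X, so distinct pairs of points spanning
   the same subset contribute a single line. *)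
Definition lines d (X : finPOrderType d) : {set {set X}} :=
  [set line p.1 p.2 | p : X * X & p.1 != p.2].

Arguments height {d} X.
Arguments lines {d} X.

(* Main.v *)
Require Import Defs.
From mathcomp Require Import all_boot all_order.
From mathcomp Require Import zify.

(** A longest chain [C] meets each of the [h] antichains [A_1, ..., A_h] of a
    partition of the poset exactly once.  An incomparable pair is a line by
    itself, and convexity of the binomial coefficient gives the first two terms
    of the bound from the pairs inside a single [A_i].  The remaining [h] lines
    are found one for each point of [C].  A point of [C] that is incomparable to
    some point of another [A_j] supplies that pair.  The other points [g] of [C]
    have pairwise disjoint sets [N g] of points incomparable to [g], at most one
    of which is empty as no line is universal; since the line through two points
    [g], [g'] of [C] is the complement of [N g :|: N g'], they span enough
    distinct lines, among themselves or with one point outside [C]. *)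

Set Implicit Arguments.
Unset Strict Implicit.
Unset Printing Implicit Defensive.
Import Order.TTheory.

(** * Convexity of the number of pairs *)

Lemma bin2_double (m : nat) : 'C(m, 2).*2 + m = m * m.
Proof. by elim: m => // m; rewrite binS bin1; lia. Qed.

(* Convexity: the difference of the two sides is (a - q)(a - q - 1) / 2. *)
Lemma bin2_tangent (q a : nat) : q * a <= 'C(a, 2) + 'C(q.+1, 2).
Proof.
have := bin2_double a; have := bin2_double q.+1.
by case: (leqP a q) => /subnK <-; nia.
Qed.

(** The tangent bound with [q = n %/ h] is summed over [i]; it is exact at [q] and [q.+1], the
    values of a balanced partition. *)
Lemma sum_bin2_ge (h : nat) (a : 'I_h -> nat) (n := \sum_i a i) :
  h * 'C(n %/ h, 2) + (n %/ h) * (n %% h) <= \sum_i 'C(a i, 2).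
Proof.
set q := n %/ h.
have: \sum_i q * a i <= \sum_i ('C(a i, 2) + 'C(q.+1, 2)).
  by apply: leq_sum => i _; exact: bin2_tangent.
rewrite -big_distrr big_split /= sum_nat_const card_ord -/n.
have := divn_eq n h; rewrite -/q binS bin1.
by have := bin2_double q; nia.
Qed.

(** * Lines of comparable and of incomparable pairs *)

Section Lines.
Variables (d : Order.disp_t) (X : finPOrderType d).
Implicit Types (x y z : X) (A C G : {set X}).

Lemma line_sym x y : line x y = line y x.
Proof.
apply/setP=> z; rewrite !inE /between (orbC (z == x)); congr orb.
by do !case: (_ < _)%O.
Qed.

Lemma in_line x y z : x != y -> (x >=< y)%O ->
  (z \in line x y) = (x >=< z)%O && (y >=< z)%O.
Proof.
wlog lxy : x y / (x < y)%O => [lem nxy cxy|_ _].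
  case: (comparable_ltgtP cxy) nxy => // [lxy|lyx] _.
    by rewrite lem // lt_eqF.
  by rewrite line_sym andbC lem // ?lt_eqF // comparable_sym.
rewrite !inE /between /Order.comparable !le_eqVlt !(eq_sym _ z).
have [->|nzx] := eqVneq z x; first by rewrite lxy !orbT.
have [->|nzy] := eqVneq z y; first by rewrite lxy !orbT.
have := @lt_trans _ _ y x z; have := @lt_trans _ _ x z y.
rewrite lxy (lt_gtF lxy) /=.
by do 4!case: (_ < _)%O => //=; do ?[by move/(_ isT isT) | move=> _].
Qed.

Lemma line_incomparable x y : (x >< y)%O -> line x y = [set x; y].
Proof.
move=> nxy; apply/setP=> z; rewrite !inE; apply/orb_idr.
have [nlxy nlyx] : (x < y)%O = false /\ (y < x)%O = false.
  by move: nxy; rewrite /Order.comparable !le_eqVlt;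
     do 2!case: (_ < _)%O; rewrite ?orbT.
rewrite /between nlxy nlyx !andbF /= => /orP[]//.
by case/orP=> /andP[l1 l2]; have := lt_trans l1 l2; rewrite ?nlxy ?nlyx.
Qed.

Definition incomparable_set x : {set X} := [set y | (x >< y)%O].

Definition incomparable_pairs : {set {set X}} :=
  [set A : {set X} | (#|A| == 2) && ~~ chain A].

Definition comparable_lines : {set {set X}} :=
  [set line p.1 p.2 | p : X * X & (p.1 != p.2) && (p.1 >=< p.2)%O].

Lemma chain_set2 x y : chain [set x; y] = (x >=< y)%O.
Proof.
apply/forall_inP/idP => [cC|cxy z].
  by apply: (forall_inP (cC x _)); rewrite !inE eqxx ?orbT.
by rewrite !inE => /orP[]/eqP->; apply/forall_inP => t;
  rewrite !inE => /orP[]/eqP->; rewrite ?comparablexx // comparable_sym.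
Qed.

Lemma mem_comparable_lines x y :
  x != y -> (x >=< y)%O -> line x y \in comparable_lines.
Proof.
by move=> nxy cxy; apply/imsetP; exists (x, y); rewrite ?inE /= ?nxy.
Qed.

Lemma chainP C : reflect {in C &, forall x y, (x >=< y)%O} (chain C).
Proof.
apply: (iffP forall_inP) => [cC x y Cx|cC x Cx]; last first.
  by apply/forall_inP=> y; exact: cC.
exact: (forall_inP (cC x Cx)).
Qed.

(** A line through a comparable pair contains that pair, so if it has only two points it is a chain,
    hence not an incomparable pair. *)
Lemma card_lines_ge : #|incomparable_pairs| + #|comparable_lines| <= #|lines X|.
Proof.
have dis : [disjoint incomparable_pairs & comparable_lines].
  apply/pred0P=> A /=; apply/negbTE/negP => /andP[].
  rewrite inE => /andP[A2 ncA] /imsetP[[a b]].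
  rewrite inE /= => /andP[nab cab] defA; case/negP: ncA.
  suff -> : A = [set a; b] by rewrite chain_set2.
  apply/esym/eqP; rewrite eqEcard (eqP A2) cards2 nab defA andbT.
  exact: subsetUl.
have /eqP <- : #|incomparable_pairs :|: comparable_lines| ==
    #|incomparable_pairs| + #|comparable_lines| by rewrite (leq_card_setU _ _).
apply/subset_leq_card/subsetP => A; rewrite inE => /orP[|/imsetP[p]].
  rewrite inE => /andP[/cards2P[x [y [nxy ->]]]].
  rewrite chain_set2 => ncxy; rewrite -line_incomparable //.
  by apply/imsetP; exists (x, y); rewrite ?inE.
by rewrite inE => /andP[np _] ->; apply/imset_f; rewrite inE.
Qed.

Lemma chain_lines_ge G :
    [set: X] \notin lines X -> chain G -> 2 <= #|G| ->
    {in G &, forall g g', g != g' ->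
       [disjoint incomparable_set g & incomparable_set g']} ->
  #|G| <= #|comparable_lines|.
Proof.
move=> no_univ /chainP cG G2 disN.
have disE g g' y : g \in G -> g' \in G -> (g >< y)%O -> (g' >< y)%O -> g = g'.
  move=> Gg Gg' gy g'y; apply/eqP/negPn/negP => /(disN _ _ Gg Gg')/pred0P/(_ y).
  by rewrite !inE gy g'y.
have inG g g' z : g \in G -> g' \in G -> g != g' ->
    (z \notin line g g') = (g >< z)%O || (g' >< z)%O.
  by move=> Gg Gg' ngg'; rewrite in_line ?(cG g g') ?negb_and.
(* Take for [g0] a point of [G] comparable to everything, if there is one, and any point otherwise;
   a second such point would span a universal line with [g0]. *)
have [g0 Gg0 ne] : exists2 g0, g0 \in G &
    {in G, forall g, g != g0 -> exists y, (g >< y)%O}.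
  have [/exists_inP[g0 Gg0 /eqP N0]|/exists_inPn noN0] :=
      boolP [exists g in G, incomparable_set g == set0].
    exists g0 => // g Gg ng0; apply/existsP; apply: contraR no_univ.
    move=> /existsPn Ng; apply/imsetP; exists (g0, g); rewrite ?inE 1?eq_sym //=.
    apply/esym/setP=> z; rewrite in_line ?(cG g0 g) 1?eq_sym // inE.
    rewrite (negbNE (Ng z)) andbT.
    by have := in_set0 z; rewrite -N0 inE => /negbFE.
  have [g0 Gg0] : exists g0, g0 \in G by apply/set0Pn; rewrite -card_gt0; lia.
  exists g0 => // g Gg _; have /set0Pn[y] := noN0 g Gg.
  by rewrite inE; exists y.
(* Some point is incomparable to [g'], hence off [line g0 g]; disjointness rules out [g0] as the
   cause and identifies [g] with [g']. *)
have absorb g g' : g \in G -> g' \in G -> g != g0 -> g' != g0 ->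
    (forall z, (g' >< z)%O -> z \notin line g0 g) -> g' = g.
  move=> Gg Gg' ng0 ng'0 sub; have [y g'y] := ne g' Gg' ng'0.
  have := sub y g'y; rewrite inG 1?eq_sym //.
  case/orP=> [g0y|gy]; last exact: (disE _ _ y).
  by rewrite (disE g' g0 y) ?eqxx in ng'0.
pose F := [set line g0 g | g in G :\ g0].
have FE : #|G| = #|F|.+1.
  rewrite (cardsD1 g0 G) Gg0 card_in_imset // => g g'.
  rewrite !inE => /andP[ng0 Gg] /andP[ng'0 Gg'] eqL; apply: absorb => // z gz.
  by rewrite -eqL inG 1?eq_sym // gz orbT.
(* The lines through [g0] fall short of [#|G|] by one.  The missing one is a line
   through two other points of [G], or, if [G = [set g0; g1]], the line through
   [g0] and a point [y1] incomparable to [g1], which is then comparable to [g0]. *)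
suff [L LV LF] : exists2 L, L \in comparable_lines & L \notin F.
  have -> : #|G| = #|L |: F| by rewrite cardsU1 LF FE.
  apply/subset_leq_card/subsetP=> A; rewrite inE => /orP[/set1P->//|/imsetP[g]].
  by rewrite !inE => /andP[ng0 Gg] ->;
     rewrite mem_comparable_lines ?cG 1?eq_sym.
have [g1 G1 n10] : exists2 g1, g1 \in G & g1 != g0.
  have /set0Pn[g1] : G :\ g0 != set0.
    by rewrite -card_gt0; rewrite (cardsD1 g0) Gg0 in G2.
  by rewrite !inE => /andP[]; exists g1.
have [/existsP[g2 /and3P[G2' n20 n21]]|/existsPn only] :=
    boolP [exists g2, [&& g2 \in G, g2 != g0 & g2 != g1]].
  exists (line g1 g2); first by rewrite mem_comparable_lines ?cG 1?eq_sym.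
  apply/imsetP=> -[g]; rewrite !inE => /andP[ng0 Gg] eqL.
  have [e1 e2] : g1 = g /\ g2 = g.
    by split; apply: absorb => // z gz; rewrite -eqL inG 1?eq_sym // gz ?orbT.
  by rewrite e1 e2 eqxx in n21.
have [y1 gy1] := ne g1 G1 n10.
have c01 : (g0 >=< y1)%O.
  by apply/negPn/negP => c; rewrite (disE g0 g1 y1) ?eqxx in n10.
have n01 : g0 != y1.
  by apply: contraNneq gy1 => <-; exact: cG.
exists (line g0 y1); first exact: mem_comparable_lines.
apply/imsetP=> -[g]; rewrite !inE => /andP[ng0 Gg] eqL.
have g1E : g = g1 by apply/eqP; have := only g; rewrite Gg ng0 /= negbK.
(* The point [y1] lies on [line g0 y1] but not on [line g0 g1]. *)
have: y1 \notin line g0 g by rewrite inG 1?eq_sym // g1E gy1 orbT.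
by rewrite -eqL in_line // c01 comparablexx.
Qed.

(** * Longest chains and partition into antichains *)

Lemma chain_add_top C x :
  chain C -> {in C, forall z, (z < x)%O} ->
  chain (x |: C) /\ #|x |: C| = #|C|.+1.
Proof.
move=> /chainP cC ltx; split; last first.
  by rewrite cardsU1; case: (boolP (x \in C)) => // /ltx; rewrite ltxx.
apply/chainP=> y z; rewrite !inE.
move=> /orP[/eqP->|Cy] /orP[/eqP->|Cz]; last exact: cC.
- exact: comparablexx.
- by rewrite comparable_sym; apply/lt_comparable/ltx.
- exact/lt_comparable/ltx.
Qed.

Lemma leq_height C : chain C -> #|C| <= height X.
Proof.
by move=> cC; exact: (@leq_bigmax_cond _ _ (fun C : {set X} => #|C|)).
Qed.

(** Mirsky's colouring: the colour of [x] is the largest size of a chain strictly below [x]. Adding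
    [x] to such a chain shows that the colour is less than the height and increases along the
    order. *)
Lemma exists_antichain_coloring :
  exists f : X -> 'I_(height X), forall x y, (x < y)%O -> f x != f y.
Proof.
pose below x C := chain C && [forall z in C, (z < x)%O].
pose f x := \max_(C | below x C) #|C|.
have below0 x : below x set0.
  by apply/andP; split; [apply/chainP|apply/forall_inP] => z; rewrite inE.
have fE x : exists2 C, below x C & f x = #|C|.
  have [|C bC fC] :=
      @eq_bigmax_cond _ [pred C | below x C] (fun C : {set X} => #|C|).
    by apply/card_gt0P; exists set0; exact: below0.
  by exists C.
have fh x : f x < height X.
  have [C /andP[cC /forall_inP ltC] ->] := fE x.
  by have [/leq_height ? <-] := chain_add_top cC ltC.
exists (fun x => Ordinal (fh x)) => x y lxy; rewrite -val_eqE /= neq_ltn.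
have [C /andP[cC /forall_inP ltC] ->] := fE x.
have [cC' <-] := chain_add_top cC ltC.
rewrite (@leq_bigmax_cond _ _ (fun C : {set X} => #|C|)) // /below cC'.
by apply/forall_inP => z; rewrite !inE => /orP[/eqP->//|/ltC/lt_trans]; exact.
Qed.

Lemma exists_longest_chain : exists2 C : {set X}, chain C & #|C| = height X.
Proof.
have [|C cC eC] :=
    @eq_bigmax_cond _ [pred C : {set X} | chain C] (fun C : {set X} => #|C|).
  by apply/card_gt0P; exists set0; apply/chainP => x; rewrite inE.
by exists C; last exact: esym eC.
Qed.

(** Colour classes are antichains, so every pair inside one is incomparable, and no pair lies in two
    classes. *)
Lemma same_color_pairs_ge (h : nat) (f : X -> 'I_h)
    (U := [set A : {set X} in incomparable_pairs |
             [exists i, A \subset f @^-1: [set i]]]) :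
  (forall x y, (x < y)%O -> f x != f y) ->
  h * 'C(#|X| %/ h, 2) + (#|X| %/ h) * (#|X| %% h) <= #|U|.
Proof.
move=> f_lt; pose a i := #|f @^-1: [set i]|.
have -> : #|X| = \sum_i a i.
  rewrite -sum1_card (partition_big f xpredT) //=; apply: eq_bigr => i _.
  by rewrite sum1_card; apply: eq_card => x; rewrite !inE.
apply: (leq_trans (sum_bin2_ge a)).
pose D i := [set A : {set X} | A \subset f @^-1: [set i] & #|A| == 2].
have disD i j : i != j -> [disjoint D i & D j].
  move=> nij; apply/pred0P=> A /=; rewrite !inE; apply/negbTE/negP.
  move=> /andP[/andP[/subsetP Ai A2] /andP[/subsetP Aj _]].
  have /card_gt0P[x Ax] : 0 < #|A| by rewrite (eqP A2).
  have := Ai x Ax; have := Aj x Ax; rewrite !inE => /eqP-> /eqP ji.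
  by rewrite ji eqxx in nij.
have -> : \sum_i 'C(a i, 2) = #|\bigcup_i D i|.
  rewrite -sum1_card partition_disjoint_bigcup //.
  by apply: eq_bigr => i _; rewrite sum1_card cards_draws.
apply/subset_leq_card/bigcupsP=> i _; apply/subsetP=> A; rewrite !inE.
move=> /andP[Ai A2]; rewrite A2 /=; apply/andP; split;
  last by apply/existsP; exists i.
case/cards2P: A2 Ai => x [y [nxy ->]]; rewrite chain_set2 subUset !sub1set !inE.
move=> /andP[/eqP fx /eqP fy]; apply/negP => cxy.
by case: (comparable_ltgtP cxy) nxy => // /f_lt; rewrite fx fy eqxx.
Qed.

End Lines.

Theorem theorem2 (d : Order.disp_t) (X : finPOrderType d)
    (no_universal_line : [set: X] \notin lines X)
    (height_ge2 : 2 <= height X) :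
  let n := #|X| in
  let h := height X in
  h * 'C(n %/ h, 2) + (n %/ h) * (n %% h) + h <= #|lines X|.
Proof.
cbv zeta; have [f f_lt] := exists_antichain_coloring X.
have [C cC Ch] := exists_longest_chain X; have /chainP cC' := cC.
apply: leq_trans (card_lines_ge X).
set U := incomparable_pairs X.
pose S (A : {set X}) := [exists i, A \subset f @^-1: [set i]].
(* Pairs inside a colour class give the first two terms; two-coloured pairs and comparable lines
   must supply [h] more. *)
rewrite -(cardsID [set A : {set X} | S A] U) -[leqRHS]addnA; apply: leq_add.
  apply: leq_trans (same_color_pairs_ge f_lt) _.
  by apply/subset_leq_card/subsetP=> A; rewrite !inE.
have f_inj : {in C &, injective f}.
  move=> x y Cx Cy fxy; apply/eqP/negPn/negP => nxy.
  by case: (comparable_ltgtP (cC' x y Cx Cy)) nxy => // /f_lt; rewrite fxy eqxx.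
pose bad x y := (x >< y)%O && (f x != f y).
pose B := [set x in C | [exists y, bad x y]].
(* The default [x] is never taken on [B]. *)
pose wit x := odflt x [pick y | bad x y].
have bad_wit x : x \in B -> bad x (wit x).
  by rewrite inE /wit => /andP[_ /existsP[y xy]];
     case: pickP => [//|/(_ y)]; rewrite xy.
rewrite -Ch -(cardsID B C) (setIidPr _);
  last by apply/subsetP=> x; rewrite inE => /andP[].
apply: leq_add.
  have <- : #|[set [set x; wit x] | x in B]| = #|B|.
    apply: card_in_imset => x y Bx By eqxy; apply/eqP/negPn/negP => nxy.
    (* Otherwise [x] is [wit y], incomparable to [y] although both lie in the chain [C]. *)
    have: x \in [set y; wit y] by rewrite -eqxy !inE eqxx.
    rewrite !inE (negPf nxy) /= => /eqP x_wit.
    have /andP[/negP[]] := bad_wit y By; rewrite -x_wit cC' //.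
      by move: By; rewrite inE => /andP[].
    by move: Bx; rewrite inE => /andP[].
  apply/subset_leq_card/subsetP=> _ /imsetP[x Bx ->].
  have /andP[x_wit f_wit] := bad_wit x Bx.
  rewrite !inE chain_set2 x_wit cards2 andbT; apply/andP; split.
    apply/existsPn => i; rewrite subUset !sub1set !inE.
    by apply: contra f_wit => /andP[/eqP-> /eqP->].
  by have -> : x != wit x by apply: contraNneq f_wit => <-.
have [G2|G1] := leqP 2 #|C :\: B|.
  apply: (@chain_lines_ge _ _ (C :\: B)) => //.
    by apply/chainP=> x y /setDP[Cx _] /setDP[Cy _]; exact: cC'.
  move=> x y /setDP[Cx nBx] /setDP[Cy nBy] nxy.
  (* Outside [B], a point of [C] has its own colour on all points incomparable to it, and colours
     are distinct along [C]; hence the disjointness. *)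
  have same u z : u \in C -> u \notin B -> (u >< z)%O -> f u = f z.
    move=> Cu; rewrite inE Cu /= => /existsPn/(_ z); rewrite /bad => /[swap] ->.
    by rewrite negbK => /eqP.
  apply/pred0P=> z /=; rewrite !inE; apply/negbTE/andP => -[xz yz].
  by case/eqP: nxy; apply: f_inj => //; rewrite (same x z) // (same y z).
(* At most one point of [C] is left, so any line through two points of [C] suffices. *)
apply: leq_trans (_ : 1 <= _) => //; apply/card_gt0P.
have /card_gt1P[x [y [Cx Cy nxy]]] : 1 < #|C| by rewrite Ch.
by exists (line x y); rewrite mem_comparable_lines ?cC'.
Qed.
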